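(* Let $G$ and $H$ be étale groupoids with locally compact Hausdorff unit spaces and let $h:G\curvearrowright H$ be a proper actor with anchor map $\rho:H\to G^{(0)}$. Suppose $G$ is Hausdorff. For an open bisection $U\subseteq G$, the stable set $S_U$ has meagre intersection with every precompact open subset of $H^{(0)}$ if and only if it is empty. In particular, the following are equivalent: the induced ${}^*$-homomorphism $\varphi_h:C^*(G)\to C^*(H)$ entwines the canonical local expectations; $S_U$ is empty for all bisections $U\subseteq G$; $h$ is free.
   Context: $H$ is not assumed globally Hausdorff. For an open bisection $U\subseteq G$, $\mathcal{C}_c(U)$ is the space of continuous compactly supported functions $U\to\mathbb{C}$, extended by zero to $G$; $\mathcal{C}_c(G)$ is the linear span of these over all open bisections, a ${}^*$-algebra with convolution $(fg)(\gamma)=\sum_{\eta\in G_{r(\gamma)}}f(\eta^{-1})g(\eta\gamma)$ ($G_y=s^{-1}(\{y\})$) and involution $f^*(\gamma)=\overline{f(\gamma^{-1})}$; $C^*(G)$ is its completion in the maximal $C^*$-norm. An actor $h:G\curvearrowright H$ consists of a continuous anchor map $\rho:H\to G^{(0)}$ and a continuous multiplication $\{(\gamma,x)\in G\times H: s(\gamma)=\rho(x)\}\to H$, $(\gamma,x)\mapsto\gamma\cdot x$, such that $\rho(\gamma\cdot x)=r(\gamma)$; $\gamma_1\cdot(\gamma_2\cdot x)=(\gamma_1\gamma_2)\cdot x$ whenever $s(\gamma_1)=r(\gamma_2)$ and $s(\gamma_2)=\rho(x)$; $\rho(x)\cdot x=x$; and, whenever $s(\gamma)=\rho(x)$ and $(x,y)\in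 H^{(2)}$, $\rho(xy)=\rho(x)$, $s(\gamma\cdot x)=s(x)$ and $\gamma\cdot(xy)=(\gamma\cdot x)y$. It is proper if $\rho|_{H^{(0)}}$ is a proper map $H^{(0)}\to G^{(0)}$. It is free if for every $t\in H^{(0)}$ and $\gamma\in G_{\rho(t)}$ we have $\gamma\cdot t=t$ if and only if $\gamma=s(\gamma)$. For a proper actor, $\varphi_h:C^*(G)\to C^*(H)$ is the continuous extension of the ${}^*$-homomorphism $\mathcal{C}_c(G)\to\mathcal{C}_c(H)$ given by $[\varphi_h(f)](x)=\sum f(\gamma)$, the sum over all $\gamma\in G_{\rho(s(x))}$ with $x=\gamma\cdot s(x)$. It maps $C_0(G^{(0)})$ into $C_0(H^{(0)})$. For a bisection $U\subseteq G$, $S_U:=\{t\in H^{(0)}:\exists\,\gamma\in U\setminus G^{(0)},\ s(\gamma)=\rho(t),\ \gamma\cdot t=t\}$. A set is meagre if it is a countable union of nowhere dense sets. For a locally compact Hausdorff space $X$, the local multiplier algebra $M_{\mathrm{loc}}(C_0(X))$ is identified with $\mathfrak{B}(X)/\mathfrak{M}(X)$, where $\mathfrak{B}(X)$ is the algebra of bounded Borel functions on $X$ and $\mathfrak{M}(X)$ the ideal of those vanishing on a comeagre set. The canonical local expectation $EL_H:C^*(H)\to M_{\mathrm{loc}}(C_0(H^{(0)}))$ is the continuous extension of the map sending $f\in\mathcal{C}_c(H)$ to the class of $f|_{H^{(0)}}$; similarly $EL_G$. The map $\varphi_h$ entwines the canonical local expectations if $EL_H\circ\varphi_h=\tilde\varphi\circ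 EL_G$, where $\tilde\varphi$ is the extension of $\varphi_h|_{C_0(G^{(0)})}$ to local multiplier algebras; since $G$ is Hausdorff, $EL_G$ takes values in $C_0(G^{(0)})$ and this condition reads $EL_H(\varphi_h(f))=\varphi_h(EL_G(f))$ for all $f\in C^*(G)$. *)

(* Defs.v *)
From HB Require Import structures.
From mathcomp Require Import all_boot all_order all_algebra.
From mathcomp Require Import generic_quotient complex.
From mathcomp Require Import all_classical all_reals all_analysis.

Set Implicit Arguments.
Unset Strict Implicit.
Unset Printing Implicit Defensive.

Import Order.TTheory GRing.Theory Num.Theory.
Import numFieldNormedType.Exports.
Local Open Scope classical_set_scope.
Local Open Scope quotient_scope.
Local Open Scope ring_scope.
Local Open Scope complex_scope.

(** The scalars are [R[i]] for a [realType] [R]; MathComp-Analysis puts the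
    norm topology on the alias [R[i]^o], hence the casts in continuity
    statements. *)

(** ** Topology *)

(* The map [g] is the inverse homeomorphism [f @` U -> U]. *)
Definition local_homeomorphism (S T : topologicalType) (f : S -> T) : Prop :=
  continuous f /\
  forall x : S, exists (U : set S) (g : T -> S),
    [/\ open U, U x, open (f @` U), {in U, cancel f g} &
        {within f @` U, continuous g}].

Definition proper_map (S T : topologicalType) (f : S -> T) : Prop :=
  continuous f /\ forall K : set T, compact K -> compact (f @^-1` K).

Definition nowhere_dense (X : topologicalType) (A : set X) : Prop :=
  interior (closure A) = set0.

Definition meagre (X : topologicalType) (A : set X) : Prop :=
  exists F : nat -> set X,
    (forall n, nowhere_dense (F n)) /\ A = \bigcup_n F n.

Definition comeagre (X : topologicalType) (A : set X) : Prop := meagre (~` A).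

Lemma meagre0 (X : topologicalType) : meagre (@set0 X).
Proof.
exists (fun=> set0); split; last by rewrite bigcup0.
by move=> _; rewrite /nowhere_dense closure0 interior0.
Qed.

Lemma meagreU (X : topologicalType) (A B : set X) :
  meagre A -> meagre B -> meagre (A `|` B).
Proof.
move=> [F [ndF ->]] [K [ndK ->]].
exists (fun n => if odd n then K n./2 else F n./2); split.
  by move=> n; case: ifP.
apply/seteqP; split => x.
  case=> -[n _ Fx].
    by exists n.*2 => //; rewrite odd_double doubleK.
  by exists n.*2.+1 => //=; rewrite odd_double /= uphalf_double.
case=> n _; case: ifP => _ Fx; [right|left]; by exists n./2.
Qed.

Definition C0 (R : realType) (X : topologicalType) (f : X -> R[i]) : Prop :=
  continuous (f : X -> R[i]^o) /\
  forall e : R, 0 < e -> compact [set x | e%:C <= `|f x|].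

(** ** The local multiplier algebra of C_0(X), as B(X)/M(X) *)

Definition borel_fun (R : realType) (X : topologicalType) (f : X -> R[i]) :
  Prop :=
  forall V : set R[i]^o, open V -> <<s @open X >> (f @^-1` V).

Definition bounded_borel (R : realType) (X : topologicalType) :
    set (X -> R[i]) :=
  [set f | borel_fun f /\ exists M : R, forall x, `|f x| <= M%:C].

Definition bborel (R : realType) (X : topologicalType) : choiceType :=
  {f : X -> R[i] | f \in @bounded_borel R X}.

Definition vanishes_comeagrely (R : realType) (X : topologicalType)
    (f : X -> R[i]) : Prop :=
  exists2 A : set X, comeagre A & forall x, A x -> f x = 0.

Definition mloc_eq (R : realType) (X : topologicalType) (f g : bborel R X) :
  bool := `[< vanishes_comeagrely (fun x => val f x - val g x) >].

Lemma mloc_eq_equiv (R : realType) (X : topologicalType) :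
  equiv_class_of (@mloc_eq R X).
Proof.
split.
- move=> f; apply/asboolP; exists setT; last by move=> x _; rewrite subrr.
  by rewrite /comeagre setCT; exact: meagre0.
- suff sym (f g : bborel R X) : mloc_eq f g -> mloc_eq g f.
    by move=> f g; apply/idP/idP; exact: sym.
  move=> /asboolP[A cA fg]; apply/asboolP; exists A => // x /fg.
  by move=> /eqP; rewrite subr_eq0 => /eqP ->; rewrite subrr.
- move=> g f h /asboolP[A cA fg] /asboolP[B cB gh]; apply/asboolP.
  exists (A `&` B); first by rewrite /comeagre setCI; exact: meagreU.
  by move=> x [/fg fgx /gh ghx]; rewrite -[LHS](subrKA (val g x)) fgx ghx addr0.
Qed.

Canonical mloc_equiv (R : realType) (X : topologicalType) :=
  EquivRelPack (@mloc_eq_equiv R X).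

Definition Mloc (R : realType) (X : topologicalType) : Type :=
  {eq_quot @mloc_equiv R X}.

Definition mloc_class (R : realType) (X : topologicalType) (f : bborel R X) :
  Mloc R X := \pi_({eq_quot @mloc_equiv R X}) f.

(* [c] is the class of the function [f]; includes [f] being in B(X). *)
Definition is_class_of (R : realType) (X : topologicalType) (f : X -> R[i])
    (c : Mloc R X) : Prop :=
  exists2 b : bborel R X, val b = f & c = mloc_class b.

(* The distance of the quotient norm: the infimum of the supremum norm over
   all representatives of [c - d]. *)
Definition mloc_dist (R : realType) (X : topologicalType) (c d : Mloc R X) : R :=
  inf [set M : R | 0 <= M /\ exists f g : bborel R X,
    [/\ mloc_class f = c, mloc_class g = d &
        forall x, `|val f x - val g x| <= M%:C]].

(** ** Topological groupoids *)

(* The unit space is a separate space [units], identified with a subspace of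
   the arrow space through [one]; it is an embedding because it is a continuous
   section of [src].  [mulg x y] is meaningful only if [src x = rng y]. *)
Record topGroupoid := TopGroupoid {
  arrows :> topologicalType ;
  units : topologicalType ;
  src : arrows -> units ;
  rng : arrows -> units ;
  one : units -> arrows ;
  mulg : arrows -> arrows -> arrows ;
  invg : arrows -> arrows ;
  src_one : forall t, src (one t) = t ;
  rng_one : forall t, rng (one t) = t ;
  src_mulg : forall x y, src x = rng y -> src (mulg x y) = src y ;
  rng_mulg : forall x y, src x = rng y -> rng (mulg x y) = rng x ;
  mulgA : forall x y z, src x = rng y -> src y = rng z ->
    mulg x (mulg y z) = mulg (mulg x y) z ;
  mul_rng : forall x, mulg (one (rng x)) x = x ;
  mul_src : forall x, mulg x (one (src x)) = x ;
  src_invg : forall x, src (invg x) = rng x ;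
  rng_invg : forall x, rng (invg x) = src x ;
  mul_invg : forall x, mulg (invg x) x = one (src x) ;
  mul_ginv : forall x, mulg x (invg x) = one (rng x) ;
  src_continuous : continuous src ;
  rng_continuous : continuous rng ;
  one_continuous : continuous one ;
  invg_continuous : continuous invg ;
  mulg_continuous :
    {within [set p : arrows * arrows | src p.1 = rng p.2],
      continuous (fun p => mulg p.1 p.2)}
}.

Arguments units : clear implicits.
Arguments one : clear implicits.

Definition etale (G : topGroupoid) : Prop :=
  local_homeomorphism (@src G) /\ local_homeomorphism (@rng G).

Definition bisection (G : topGroupoid) (U : set G) : Prop :=
  set_inj U (@src G) /\ set_inj U (@rng G).

Definition open_bisection (G : topGroupoid) (U : set G) : Prop :=
  open U /\ bisection U.

(** ** The convolution algebra *)

(* C_c(U), extended by zero; [U `&` closure _] is the closure in [U]. *)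
Definition Cc_on (R : realType) (G : topGroupoid) (U : set G)
    (f : G -> R[i]) : Prop :=
  [/\ {within U, continuous (f : G -> R[i]^o)},
      forall x, ~ U x -> f x = 0 &
      compact (U `&` closure [set x | f x != 0])].

Definition Cc (R : realType) (G : topGroupoid) : set (G -> R[i]) :=
  [set f | exists (n : nat) (U : 'I_n -> set G) (c : 'I_n -> R[i])
             (g : 'I_n -> G -> R[i]),
    (forall k, open_bisection (U k) /\ Cc_on (U k) (g k)) /\
    forall x, f x = \sum_(k < n) c k * g k x].

(* Finitely supported sums on [Cc], whose elements have finite support on each
   source fibre. *)
Definition conv (R : realType) (G : topGroupoid) (f g : G -> R[i]) :
    G -> R[i] :=
  fun x => \sum_(y \in [set y : G | src y = rng x]) f (invg y) * g (mulg y x).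

Definition adj (R : realType) (G : topGroupoid) (f : G -> R[i]) : G -> R[i] :=
  fun x => Num.conj (f (invg x)).

(* As for [`|_|] in MathComp, norms take their values in the nonnegative
   elements of [R[i]]. *)
Definition cstar_norm (R : realType) (G : topGroupoid)
    (p : (G -> R[i]) -> R[i]) : Prop :=
  (forall f, Cc f -> 0 <= p f) /\
  (forall f, Cc f -> p f = 0 -> forall x, f x = 0) /\
  (forall f g, Cc f -> Cc g -> p (fun x => f x + g x) <= p f + p g) /\
  (forall (a : R[i]) f, Cc f -> p (fun x => a * f x) = `|a| * p f) /\
  (forall f g, Cc f -> Cc g -> p (conv f g) <= p f * p g) /\
  (forall f, Cc f -> p (conv (adj f) f) = p f ^+ 2).

Definition maximal_cstar_norm (R : realType) (G : topGroupoid)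
    (p : (G -> R[i]) -> R[i]) : Prop :=
  cstar_norm p /\
  forall q, cstar_norm q -> forall f, Cc f -> q f <= p f.

(* A (not necessarily unital) C*-algebra. *)
Record cstarAlgebra (R : realType) := CstarAlgebra {
  cs_space :> completeNormedModType R[i] ;
  cs_mul : cs_space -> cs_space -> cs_space ;
  cs_star : cs_space -> cs_space ;
  cs_mulA : forall a b c, cs_mul a (cs_mul b c) = cs_mul (cs_mul a b) c ;
  cs_mulDl : forall a b c, cs_mul (a + b) c = cs_mul a c + cs_mul b c ;
  cs_mulDr : forall a b c, cs_mul a (b + c) = cs_mul a b + cs_mul a c ;
  cs_mulZl : forall (z : R[i]) a b, cs_mul (z *: a) b = z *: cs_mul a b ;
  cs_mulZr : forall (z : R[i]) a b, cs_mul a (z *: b) = z *: cs_mul a b ;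
  cs_starK : forall a, cs_star (cs_star a) = a ;
  cs_starD : forall a b, cs_star (a + b) = cs_star a + cs_star b ;
  cs_starZ : forall (z : R[i]) a, cs_star (z *: a) = Num.conj z *: cs_star a ;
  cs_starM : forall a b, cs_star (cs_mul a b) = cs_mul (cs_star b) (cs_star a) ;
  cs_normM : forall a b, `|cs_mul a b| <= `|a| * `|b| ;
  cs_normC : forall a, `|cs_mul (cs_star a) a| = `|a| ^+ 2
}.

(* C*(G): a completion of C_c(G) in the maximal C*-norm, [iota] being the
   canonical map; only the values of [iota] on [Cc] matter.  Such a completion
   is unique up to a unique isomorphism compatible with [iota]. *)
Record fullCstar (R : realType) (G : topGroupoid) := FullCstar {
  fc_alg :> cstarAlgebra R ;
  iota : (G -> R[i]) -> fc_alg ;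
  iotaD : forall f g, Cc f -> Cc g ->
    iota (fun x => f x + g x) = iota f + iota g ;
  iotaZ : forall (a : R[i]) f, Cc f -> iota (fun x => a * f x) = a *: iota f ;
  iotaM : forall f g, Cc f -> Cc g ->
    iota (conv f g) = cs_mul (iota f) (iota g) ;
  iota_star : forall f, Cc f -> iota (adj f) = cs_star (iota f) ;
  iota_norm : maximal_cstar_norm (fun f => `|iota f|) ;
  iota_dense : dense (iota @` @Cc R G)
}.

(* The inclusion of C_0(units) into C*(G): the extension, continuous for
   uniform convergence, of the inclusion of C_c(units), that is of the
   functions in C_c(G) carried by the open bisection of units. *)
Definition is_C0_inclusion (R : realType) (G : topGroupoid)
    (A : fullCstar R G) (j : (units G -> R[i]) -> A) : Prop :=
  {within [set g : {uniform units G -> R[i]^o} | C0 (g : units G -> R[i])],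
    continuous (j : {uniform units G -> R[i]^o} -> A)} /\
  forall f : G -> R[i], Cc_on (range (one G)) f ->
    j (fun t => f (one G t)) = iota A f.

(* The canonical local expectation: the continuous extension of the map
   sending [f] in C_c(G) to the class of its restriction to the units. *)
Definition is_local_expectation (R : realType) (G : topGroupoid)
    (A : fullCstar R G) (EL : A -> Mloc R (units G)) : Prop :=
  (forall (a : A) (e : R), 0 < e ->
     \forall b \near a, mloc_dist (EL a) (EL b) < e) /\
  forall f : G -> R[i], Cc f ->
    is_class_of (fun t => f (one G t)) (EL (iota A f)).

(** ** Actors *)

(* [act g x] is meaningful only if [src g = anchor x]. *)
Record actor (G H : topGroupoid) := Actor {
  anchor : H -> units G ;
  act : G -> H -> H ;
  anchor_continuous : continuous anchor ;
  act_continuous :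
    {within [set p : G * H | src p.1 = anchor p.2],
      continuous (fun p => act p.1 p.2)} ;
  anchor_act : forall g x, src g = anchor x -> anchor (act g x) = rng g ;
  actA : forall g1 g2 x, src g1 = rng g2 -> src g2 = anchor x ->
    act g1 (act g2 x) = act (mulg g1 g2) x ;
  act_one : forall x, act (one G (anchor x)) x = x ;
  anchor_mul : forall x y, src x = rng y -> anchor (mulg x y) = anchor x ;
  src_act : forall g x, src g = anchor x -> src (act g x) = src x ;
  act_mul : forall g x y, src g = anchor x -> src x = rng y ->
    act g (mulg x y) = mulg (act g x) y
}.

Definition proper_actor (G H : topGroupoid) (h : actor G H) : Prop :=
  proper_map (fun t : units H => anchor h (one H t)).

Definition free_actor (G H : topGroupoid) (h : actor G H) : Prop :=
  forall (t : units H) (g : G), src g = anchor h (one H t) ->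
    (act h g (one H t) = one H t <-> g = one G (src g)).

Definition stable_set (G H : topGroupoid) (h : actor G H) (U : set G) :
    set (units H) :=
  [set t | exists g : G,
    [/\ U g, ~ range (one G) g, src g = anchor h (one H t) &
        act h g (one H t) = one H t]].

Definition phi_c (R : realType) (G H : topGroupoid) (h : actor G H)
    (f : G -> R[i]) : H -> R[i] :=
  fun x => \sum_(g \in [set g : G | src g = anchor h (one H (src x)) /\
                                    x = act h g (one H (src x))]) f g.

Definition is_induced_hom (R : realType) (G H : topGroupoid) (h : actor G H)
    (A : fullCstar R G) (B : fullCstar R H) (phi : A -> B) : Prop :=
  continuous phi /\
  forall f : G -> R[i], Cc f -> phi (iota A f) = iota B (phi_c h f).

(* For Hausdorff [G]: EL_H (phi a) = phi (EL_G a).  Here EL_G a is (the class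
   of) [g] in C_0(units G), and [k] is the element of C_0(units H) to which
   [phi] maps [g]; [jA] and [jB] are the inclusions of the C_0 algebras. *)
Definition entwines (R : realType) (G H : topGroupoid)
    (A : fullCstar R G) (B : fullCstar R H) (phi : A -> B)
    (jA : (units G -> R[i]) -> A) (jB : (units H -> R[i]) -> B)
    (ELA : A -> Mloc R (units G)) (ELB : B -> Mloc R (units H)) : Prop :=
  forall a : A, exists (g : units G -> R[i]) (k : units H -> R[i]),
    [/\ C0 g, is_class_of g (ELA a), C0 k, jB k = phi (jA g) &
        is_class_of k (ELB (phi a))].

(* Main.v *)
Require Import Defs.
From HB Require Import structures.
From mathcomp Require Import all_boot all_order all_algebra.
From mathcomp Require Import complex.
From mathcomp Require Import all_classical all_reals all_analysis.
From mathcomp Require Import lra.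

(** Over an open bisection [U] of [G], the arrow [g_t] of [U] with source
    [rho t] depends continuously on [t], hence so does [g_t . t].  Since the
    units form an open subset of [H] and a clopen subset of the Hausdorff
    groupoid [G], the stable set of [U] is open; by Baire it is meagre only if
    it is empty.

    If the actor is free, then [phi_c f] restricted to the units is
    [f|_units o rho], and the general case follows by density: for continuous
    functions the distance in [Mloc] is the uniform distance (Baire again), so
    the restrictions to the units of approximants of [a] converge uniformly.

    Conversely, a non-unit [g] fixing a unit [t] lies in an open bisection [U]
    without units.  A bump function [f] on [U] with [f g = 1] has expectation
    [0], whereas [phi_c f] does not vanish on an open neighbourhood of [t]. *)

Import Order.TTheory GRing.Theory Num.Theory.
Import numFieldNormedType.Exports.
Local Open Scope classical_set_scope.
Local Open Scope ring_scope.
Local Open Scope complex_scope.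

Set Implicit Arguments.
Unset Strict Implicit.
Unset Printing Implicit Defensive.

(** * Baire category in locally compact Hausdorff spaces *)

Section LocallyCompactHausdorff.
Variable X : topologicalType.
Hypotheses (hsX : hausdorff_space X) (lcX : locally_compact [set: X]).

Lemma lch_compact_nbhs (x : X) (U : set X) : open U -> U x ->
  exists2 V : set X, [/\ open V, V x & closure V `<=` U] &
    compact (closure V).
Proof.
move=> oU Ux; have [K] := @lcX x I; rewrite withinET => xK [cK clK].
have UKx : nbhs x (U `&` K) by apply: filterI => //; exact: open_nbhs_nbhs.
have [B xB BUK] := compact_regular hsX cK xK UKx.
have iBUK : closure (interior B) `<=` U `&` K.
  by apply: subset_trans BUK; apply: closureS; exact: interior_subset.
exists (interior B).
  split; [exact: open_interior|exact: xB|].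
  by move=> y /iBUK[].
by apply: (subclosed_compact _ cK); [exact: closed_closure|move=> y /iBUK[]].
Qed.

(** If nowhere dense sets [F n] covered [V], one could shrink [V] to nonempty open sets [W n], the
    closure of [W n.+1] being compact, inside [W n] and off [F n]. Compactness yields a point common
    to these closures; it lies in [V] but in no [F n]. *)
Lemma lch_baire (A V : set X) : meagre A -> open V -> V !=set0 -> ~ V `<=` A.
Proof.
move=> [F [ndF ->]] oV [v Vv] VF.
pose T := {W : set X | open W /\ W !=set0}.
have shrink (n : nat) (W : T) : exists W' : T,
    [/\ closure (sval W') `<=` sval W, compact (closure (sval W')) &
        forall x, closure (sval W') x -> ~ F n x].
  case: W => W /= [oW [w Ww]].
  have [x [Wx nFx]] : (W `\` closure (F n)) !=set0.
    apply: contrapT => /set0P /negP /negPn /eqP.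
    rewrite setD_eq0 => WF; have : interior (closure (F n)) w.
      exact: filterS WF (open_nbhs_nbhs (conj oW Ww)).
    by rewrite (ndF n).
  have oWF : open (W `\` closure (F n)).
    by apply: openI => //; exact/closed_openC/closed_closure.
  have [W' [oW' W'x W'W] cW'] := lch_compact_nbhs oWF (conj Wx nFx).
  exists (exist _ W' (conj oW' (ex_intro _ x W'x))); split => //=.
    by move=> y /W'W[].
  by move=> y /W'W[_ nFy] Fy; apply: nFy; exact: subset_closure.
have [s sP] := choice (fun nW : nat * T => shrink nW.1 nW.2).
(* [W 0] is [V] itself, so compact closures are available only from index [1] on. *)
pose W := fix W n := if n is m.+1 then s (m, W m)
  else exist _ V (conj oV (ex_intro _ v Vv)) : T.
have WS n : closure (sval (W n.+1)) `<=` sval (W n) by have [] := sP (n, W n).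
have Wmono m n : (m <= n)%N -> sval (W n) `<=` sval (W m).
  elim: n => [|n IH]; first by rewrite leqn0 => /eqP ->.
  rewrite leq_eqVlt => /predU1P[-> //|/IH] WnWm x Wx.
  by apply: WnWm; apply: WS; exact: subset_closure.
have [x xW] := choice (fun n => (proj2 (svalP (W n)))).
have [_ /= cK _] := sP (0%N, W 0%N).
have Fx (n : nat) : (x @ \oo) (sval (W n)).
  by exists n => // m /= /Wmono; apply; exact: xW.
(* The points [x m] of [W m] eventually stay in each [W n], so a cluster point [p] lies in every
   closure. *)
have [p [_ clp]] := cK (x @ \oo) _
  (filterS (@subset_closure _ _) (Fx 1%N)).
have pW n : closure (sval (W n)) p by move=> B pB; exact: clp (Fx n) pB.
have [n _ Fnp] := VF p (WS 0%N _ (pW 1%N)).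
by have [_ _ /(_ p (pW n.+1))] := sP (n, W n).
Qed.

End LocallyCompactHausdorff.

(** * Open maps, units and open bisections in étale groupoids *)

Section EtaleGroupoid.
Variable G : topGroupoid.
Hypothesis etG : etale G.

(** The local inverse [g] of [src] at [x] is continuous, so it sends points near [src x] into [N],
    and each such point is the source of its image. *)
Lemma etale_src_open (N : set G) : open N -> open (@src G @` N).
Proof.
move=> oN; rewrite openE => _ [x Nx <-].
have [U [g [oU Ux oSU gK cg]]] := proj2 (proj1 etG) x.
have cgx : {for src x, continuous g}.
  by move: cg; rewrite continuous_open_subspace// => /(_ (src x)); apply;
    apply/mem_set; exists x.
have gx : g (src x) = x by apply: gK; exact/mem_set.
have : nbhs (src x) (@src G @` U `&` g @^-1` N).
  apply: filterI; first by apply: open_nbhs_nbhs; split => //; exists x.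
  by apply: cgx; rewrite gx; exact: open_nbhs_nbhs.
apply: filterS => _ [[y Uy <-]]; rewrite /= gK ?inE// => Ny.
by exists y.
Qed.

(** Take an open [U] around [s t] on which [src] is injective. For an arrow [x] near [s t], both [x]
    and [s (src x)] lie in [U] and have the same source, hence coincide. *)
Lemma open_section_image (D : set (units G)) (s : units G -> G) : open D ->
  (forall t, D t -> src (s t) = t) ->
  (forall t, D t -> {for t, continuous s}) -> open (s @` D).
Proof.
move=> oD sK cs; rewrite openE => _ [t Dt <-].
have [U [g [oU Ut oSU gK cg]]] := proj2 (proj1 etG) (s t).
have injU x y : U x -> U y -> src x = src y -> x = y.
  by move=> Ux Uy e; rewrite -(gK x) ?inE// -(gK y) ?inE// e.
have : nbhs (s t) (U `&` @src G @^-1` (D `&` s @^-1` U)).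
  apply: filterI; first exact: open_nbhs_nbhs.
  apply: src_continuous; rewrite sK//; apply: filterI.
    exact: open_nbhs_nbhs.
  by apply: cs => //; exact: open_nbhs_nbhs.
apply: filterS => x [Ux [/= Dx Usx]]; exists (src x) => //.
by apply: injU => //; rewrite sK.
Qed.

Lemma open_range_one : open (range (Defs.one G)).
Proof.
apply: open_section_image => [|t _|t _]; first exact: openT.
  exact: src_one.
exact: one_continuous.
Qed.

(** The units are the points where a continuous map, [src] followed by the unit embedding, agrees
    with the identity; this is a closed condition in a Hausdorff space. *)
Lemma closed_range_one : hausdorff_space G -> closed (range (Defs.one G)).
Proof.
move=> hG; have -> : range (Defs.one G) = [set x | Defs.one G (src x) = x].
  apply/seteqP; split => [_ [t _ <-]|x /= <-]; last by exists (src x).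
  by rewrite /= src_one.
move=> x clx; apply: hG => A B A1 Bx.
have c : continuous (Defs.one G \o @src G).
  by move=> y; apply: continuous_comp;
    [exact: src_continuous|exact: one_continuous].
have [y [/= yx [Ay By]]] := clx _ (@filterI _ (nbhs x) _ _ _ (c x _ A1) Bx).
by exists y; split => //; move: Ay; rewrite /= yx.
Qed.

Lemma open_bisection_basis (N : set G) (x : G) : open N -> N x ->
  exists U : set G, [/\ open_bisection U, U x & U `<=` N].
Proof.
move=> oN Nx.
have [U [g [oU Ux _ gK _]]] := proj2 (proj1 etG) x.
have [V [k [oV Vx _ kK _]]] := proj2 (proj2 etG) x.
exists (U `&` V `&` N); split => [||y []//]; last by split.
split; first by do 2!apply: openI => //.
split=> y z; rewrite !inE => -[[Uy Vy] _] [[Uz Vz] _] e.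
  by rewrite -(gK y) ?inE// -(gK z) ?inE// e.
by rewrite -(kK y) ?inE// -(kK z) ?inE// e.
Qed.

End EtaleGroupoid.

(* Junk off [src @` U]. *)
Definition src_section (G : topGroupoid) (U : set G) (t : units G) : G :=
  xget (Defs.one G t) [set x | U x /\ src x = t].

(** * Continuous sections of the source map *)

Section SrcSection.
Context {G : topGroupoid} (U : set G).

Lemma src_sectionP (t : units G) : (@src G @` U) t ->
  U (src_section U t) /\ src (src_section U t) = t.
Proof.
by move=> [x Ux xt]; rewrite /src_section; case: xgetP => [y -> //|/(_ x)[]].
Qed.

Lemma src_sectionK (x : G) : set_inj U (@src G) -> U x ->
  src_section U (src x) = x.
Proof.
move=> injU Ux; have [|Us es] := @src_sectionP (src x); first by exists x.
by apply: injU; rewrite ?inE.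
Qed.

(** The source image of the intersection of [U] and [V] is open, and the section maps it into
    [V]. *)
Lemma src_section_continuous (t : units G) : etale G -> open U ->
  set_inj U (@src G) -> (@src G @` U) t -> {for t, continuous (src_section U)}.
Proof.
move=> etG oU injU [x Ux <-] N; rewrite src_sectionK// nbhsE => -[V [oV Vx] VN].
have : nbhs (src x) (@src G @` (U `&` V)).
  apply: open_nbhs_nbhs; split; last by exists x.
  by apply: etale_src_open => //; exact: openI.
by apply: filterS => _ [y [Uy Vy] <-] /=; rewrite src_sectionK//; exact: VN.
Qed.

End SrcSection.

(* For [U] injective under [src], [t |-> g_t . t] where [g_t] is the arrow of
   [U] with source [rho t]. *)
Definition act_section (G H : topGroupoid) (h : actor G H) (U : set G)
    (t : units H) : H :=
  act h (src_section U (anchor h (Defs.one H t))) (Defs.one H t).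

(** * Translates of units, and the stable set *)

Section ActSection.
Variables (G H : topGroupoid) (h : actor G H).
Hypotheses (etG : etale G) (etH : etale H).

Let rho (t : units H) : units G := anchor h (Defs.one H t).

Lemma unit_anchor_continuous : continuous rho.
Proof.
move=> t; apply: continuous_comp;
  [exact: one_continuous|exact: anchor_continuous].
Qed.

Lemma act_section_src (U : set G) (t : units H) : (@src G @` U) (rho t) ->
  src (act_section h U t) = t.
Proof. by move=> /src_sectionP[_ e]; rewrite src_act// src_one. Qed.

Lemma act_section_anchor (U : set G) (t : units H) : (@src G @` U) (rho t) ->
  anchor h (act_section h U t) = rng (src_section U (rho t)).
Proof. by move=> /src_sectionP[_ e]; rewrite anchor_act. Qed.

Section OpenInjective.
Variable U : set G.
Hypotheses (oU : open U) (injU : set_inj U (@src G)).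

Lemma open_act_domain : open (rho @^-1` (@src G @` U)).
Proof.
apply: open_comp => [t _|]; first exact: unit_anchor_continuous.
exact: etale_src_open.
Qed.

Lemma act_section_continuous (t : units H) : (@src G @` U) (rho t) ->
  {for t, continuous (act_section h U)}.
Proof.
(* [act] is continuous only within the set [D] of composable pairs, so [m] has to take values in [D]
   near [t]; it does on the open set where [rho u] is the source of an arrow of [U]. *)
move=> Ut; set D := [set p : G * H | src p.1 = anchor h p.2].
have e := proj2 (src_sectionP Ut).
have /subspace_continuousP ca := @act_continuous _ _ h.
pose m (u : units H) := (src_section U (rho u), Defs.one H u) : G * H.
apply: (@cvg_comp _ _ _ m (fun p : G * H => act h p.1 p.2) _
  (within D (nbhs (m t)))); last exact: (ca (m t)).
move=> P DP; rewrite /= nbhs_simpl /=.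
have cm : {for t, continuous m}.
  apply: cvg_pair; last exact: one_continuous.
  apply: (@continuous_comp _ _ _ rho); first exact: unit_anchor_continuous.
  exact: src_section_continuous.
have tU : nbhs t (rho @^-1` (@src G @` U)).
  by apply: open_nbhs_nbhs; split => //; exact: open_act_domain.
apply: (@filterS _ (nbhs t) _ _ _ _ (@filterI _ (nbhs t) _ _ _ tU (cm _ DP))).
by move=> u [/= /src_sectionP[_ eu]]; apply.
Qed.

End OpenInjective.

Lemma stable_set_section (U : set G) : set_inj U (@src G) ->
  U `&` range (Defs.one G) = set0 ->
  stable_set h U = rho @^-1` (@src G @` U) `&`
                   act_section h U @^-1` range (Defs.one H).
Proof.
move=> injU U0; apply/seteqP; split => t.
  move=> [g [Ug _ sg gt]]; have Ut : (@src G @` U) (rho t) by exists g.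
  split => //; exists t => //.
  by rewrite /act_section -sg src_sectionK.
move=> [/= /[dup] Ut /src_sectionP[Us e] [u _ ut]].
exists (src_section U (rho t)); split => //.
  by move=> r; have : set0 (src_section U (rho t)) by rewrite -U0.
(* A unit is determined by its source, and the translate of [t] has source [t]. *)
have eut : u = t by rewrite -(act_section_src Ut) -ut src_one.
by rewrite -[LHS]/(act_section h U t) -ut eut.
Qed.

Lemma stable_set_open (U : set G) : hausdorff_space G -> open_bisection U ->
  open (stable_set h U).
Proof.
(* Units never count in a stable set, so they may be removed from [U]; what is left is open because
   the units are closed. *)
move=> hG [oU [injU _]]; set V := U `\` range (Defs.one G).
have -> : stable_set h U = stable_set h V.
  apply/seteqP; split => t [g []]; last by move=> [Ug g1] _ sg gt; exists g.
  by move=> Ug g1 sg gt; exists g.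
have oV : open V by apply: openI => //; exact/closed_openC/closed_range_one.
have injV : set_inj V (@src G).
  by move=> x y; rewrite !inE => -[Ux _] [Uy _]; apply: injU; rewrite inE.
rewrite stable_set_section//; last by rewrite /V setDE -setIA setICl setI0.
rewrite openE => t [Vt rt]; apply: filterI.
  by apply: open_nbhs_nbhs; split => //; exact: open_act_domain.
apply: act_section_continuous => //; apply: open_nbhs_nbhs; split => //.
exact: open_range_one.
Qed.

Definition act_bisection (U : set G) : set H :=
  act_section h U @` (rho @^-1` (@src G @` U)).

(* Arrows of [act_bisection U] with the same range [u] come from the same [g];
   then [g^-1 . u] maps each of them to its source, so the sources agree. *)
Lemma act_bisection_open (U : set G) : open_bisection U ->
  open_bisection (act_bisection U).
Proof.
move=> [oU [injU injrU]]; split; last split.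
- apply: open_section_image => //.
  + exact: open_act_domain.
  + by move=> t; exact: act_section_src.
  + by move=> t; exact: act_section_continuous.
- move=> x y; rewrite !inE => -[t Ut <-] [u Uu <-].
  by rewrite !act_section_src// => ->.
- move=> x y; rewrite !inE => -[t Ut <-] [u Uu <-] e.
  (* The unit at [rng x'] is [mulg x' (invg x')], and the anchor ignores right factors. *)
  have anchor_rng (x' : H) : anchor h x' = rho (rng x').
    by rewrite /rho -mul_ginv anchor_mul// rng_invg.
  have eg : src_section U (rho t) = src_section U (rho u).
    have [Ust _] := src_sectionP Ut; have [Usu _] := src_sectionP Uu.
    apply: injrU; rewrite ?inE//.
    by rewrite -!act_section_anchor// !anchor_rng e.
  set g := src_section U (rho t) in eg.
  have src_of (v : units H) : (@src G @` U) (rho v) ->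
      src_section U (rho v) = g ->
      rng (act h (invg g) (Defs.one H (rng (act_section h U v)))) = v.
    move=> Uv ev; have [_ sv] := src_sectionP Uv; rewrite ev in sv.
    set y' := act_section h U v.
    have ay : anchor h y' = rng g by rewrite act_section_anchor// ev.
    have sg : src (invg g) = anchor h (Defs.one H (rng y')).
      by rewrite src_invg -ay anchor_rng.
    transitivity (rng (mulg (act h (invg g) (Defs.one H (rng y'))) y')).
      by rewrite rng_mulg// src_act// src_one.
    rewrite -act_mul// ?src_one// mul_rng /y' /act_section -/(rho v) ev.
    by rewrite actA// ?src_invg// mul_invg sv act_one rng_one.
  by rewrite -(src_of t Ut erefl) -(src_of u Uu (esym eg)) e.
Qed.

End ActSection.

(** * Compactly supported functions on a groupoid *)

Section Cc.
Variable R : realType.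

(** The arrow space may fail to be Hausdorff, so [L] need not be closed. Its image under [src] is
    compact in the Hausdorff unit space, hence closed, and injectivity of [src] on [U] keeps the
    points of [U] outside [L] away from the support. *)
Lemma Cc_onP (G : topGroupoid) (U L : set G) (f : G -> R[i]) :
  hausdorff_space (units G) -> set_inj U (@src G) ->
  {within U, continuous (f : G -> R[i]^o)} ->
  compact L -> L `<=` U -> (forall x, ~ L x -> f x = 0) -> Cc_on U f.
Proof.
move=> hG injU cf cL LU f0; split => // [x Ux|]; first by apply: f0 => /LU.
have clL : U `&` closure [set x | f x != 0] `<=` L.
  move=> x [Ux clx]; apply: contrapT => Lx.
  have oSL : open (~` (@src G @` L)).
    apply: closed_openC; apply: compact_closed => //.
    apply: continuous_compact => //.
    by apply: continuous_subspaceT; exact: src_continuous.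
  have [|y [/= /eqP fy yL]] := clx (@src G @^-1` (~` (@src G @` L))).
    apply: src_continuous; apply: open_nbhs_nbhs; split => // -[y Ly yx].
    by apply: Lx; rewrite -(injU _ _ _ _ yx) ?inE//; exact: LU.
  by apply: yL; exists y => //; apply: contrapT => /f0.
have -> : U `&` closure [set x | f x != 0] = L `&` closure [set x | f x != 0].
  by apply/seteqP; split => x [xU cx]; split => //; [exact: clL|exact: LU].
by apply: compact_closedI => //; exact: closed_closure.
Qed.

Lemma Cc_on_Cc (G : topGroupoid) (U : set G) (f : G -> R[i]) :
  open_bisection U -> Cc_on U f -> Cc f.
Proof.
move=> bU fU; exists 1%N, (fun=> U), (fun=> 1), (fun=> f); split => //.
by move=> x; rewrite big_ord1 mul1r.
Qed.

Lemma range_one_bisection (G : topGroupoid) : etale G ->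
  open_bisection (range (Defs.one G)).
Proof.
move=> etG; split; first exact: open_range_one.
by split=> x y; rewrite !inE => -[t _ <-] [u _ <-];
  rewrite ?src_one ?rng_one => ->.
Qed.

(** * The map [phi_c] on compactly supported functions *)

Section PhiC.
Variables (G H : topGroupoid) (h : actor G H).
Let rho (t : units H) : units G := anchor h (Defs.one H t).

(** At most one arrow of [U] has source [rho (src x)], so the sum has at most one nonzero term. *)
Lemma phi_cE (U : set G) (f : G -> R[i]) (x : H) : set_inj U (@src G) ->
  (forall y, ~ U y -> f y = 0) ->
  phi_c h f x = if x \in act_bisection h U
                then f (src_section U (rho (src x))) else 0.
Proof.
move=> injU f0; rewrite /phi_c -/(rho (src x)).
have inU g : U g -> src g = rho (src x) -> g = src_section U (rho (src x)).
  by move=> Ug <-; rewrite src_sectionK.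
case: ifPn => [|xU].
  rewrite inE => -[t Ut]; have st := act_section_src Ut.
  move=> xt; have sx : src x = t by rewrite -xt.
  rewrite sx in inU *.
  transitivity (\sum_(g \in [set src_section U (rho t)]) f g);
    last by rewrite fsbig_set1.
  apply/esym/fsbig_widen => [y /= ->|g [[sg _] /= gU]].
    by split; [exact: (proj2 (src_sectionP Ut))|rewrite -xt].
  by apply: f0 => Ug; apply: gU; exact: inU.
apply: fsbig1 => g [sg xg]; apply: f0 => Ug; move/negP: xU; apply.
rewrite inE; exists (src x); first by exists g.
by rewrite /act_section -/(rho (src x)) -(inU g)// -xg.
Qed.

(** Sums over [P] take the value [0] on infinite supports, so additivity is not automatic. Within
    [P], every [g k] is supported on the finite set [S], made of one arrow for each [k], which turns
    all the sums into finite ones over the same index set. *)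
Lemma phi_c_sum (n : nat) (U : 'I_n -> set G) (c : 'I_n -> R[i])
    (g : 'I_n -> G -> R[i]) (x : H) :
  (forall k, set_inj (U k) (@src G)) ->
  (forall k y, ~ U k y -> g k y = 0) ->
  phi_c h (fun y => \sum_(k < n) c k * g k y) x =
  \sum_(k < n) c k * phi_c h (g k) x.
Proof.
move=> injU g0; rewrite /phi_c -/(rho (src x)).
set P := [set y : G | _ /\ _].
pose S : set G := range (fun k => src_section (U k) (rho (src x))).
have finS : finite_set (P `&` S).
  by apply: finite_setIr; exact: finite_image.
have gS k y : P y -> ~ S y -> g k y = 0.
  move=> [sy _] Sy; apply: g0 => Uy; apply: Sy; exists k => //.
  by rewrite -sy src_sectionK.
have red (f : G -> R[i]) : (forall y, P y -> ~ S y -> f y = 0) ->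
    \sum_(y \in P) f y = \sum_(y <- finmap.enum_fset (fset_set (P `&` S))) f y.
  move=> f0; rewrite -fsbig_finite//; apply/esym/fsbig_widen => [y []//|].
  by move=> y [Py /not_andP[//|Sy]]; exact: f0.
rewrite red => [|y Py Sy]; last by rewrite big1// => k _; rewrite gS// mulr0.
rewrite exchange_big; apply: eq_bigr => k _ /=.
by rewrite red ?mulr_sumr// => y; exact: gS.
Qed.

Hypotheses (etG : etale G) (etH : etale H).
Hypothesis hsH : hausdorff_space (units H).
Hypothesis hproper : proper_actor h.

(** Properness makes [T], the preimage under [rho] of the compact source image of the support,
    compact; [phi_c h f] vanishes off the continuous image of [T]. *)
Lemma Cc_on_phi_c (U : set G) (f : G -> R[i]) : open_bisection U ->
  Cc_on U f -> Cc_on (act_bisection h U) (phi_c h f).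
Proof.
move=> bU [cf f0 cK]; have [oU [injU _]] := bU.
have [oaU [injaU _]] := act_bisection_open h etG etH bU.
set K := U `&` _ in cK.
pose T := rho @^-1` (@src G @` K).
have TU : T `<=` rho @^-1` (@src G @` U).
  by move=> t [y [Uy _] yt]; exists y.
apply: (@Cc_onP _ _ (act_section h U @` T)) => //.
- pose f' (x : H) := f (src_section U (rho (src x))).
  apply: (@subspace_eq_continuous _ _ _ (f' : H -> R[i]^o)).
    by move=> x xU; rewrite /from_subspace (phi_cE _ injU)// xU.
  apply: continuous_in_subspaceT => x; rewrite inE => -[t Ut <-].
  have st := act_section_src Ut.
  apply: (@continuous_comp _ _ _ (@src H)
    (fun u => f (src_section U (rho u)) : R[i]^o)).
    exact: src_continuous.
  rewrite st; apply: (@continuous_comp _ _ _ rho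
    (fun u => f (src_section U u) : R[i]^o)).
    exact: unit_anchor_continuous.
  apply: (@continuous_comp _ _ _ (src_section U) (f : G -> R[i]^o)).
    exact: src_section_continuous.
  move: cf; rewrite continuous_open_subspace//; apply.
  by rewrite inE; have [] := src_sectionP Ut.
- apply: continuous_compact.
    apply: continuous_in_subspaceT => t; rewrite inE => /TU Ut.
    exact: act_section_continuous.
  apply: (proj2 hproper); apply: continuous_compact => //.
  by apply: continuous_subspaceT; exact: src_continuous.
- by move=> _ [t /TU Ut <-]; exists t.
- move=> x xT; rewrite (phi_cE _ injU)//; case: ifPn => //.
  rewrite inE => -[t Ut xt]; rewrite -xt act_section_src//.
  have [Us es] := src_sectionP Ut.
  apply: contrapT => fx; apply: xT; exists t => //.
  exists (src_section U (rho t)) => //; split => //.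
  by apply: subset_closure; exact/eqP.
Qed.

Lemma Cc_phi_c (f : G -> R[i]) : Cc f -> Cc (phi_c h f).
Proof.
move=> [n [U [c [g [Ug fE]]]]].
exists n, (fun k => act_bisection h (U k)), c, (fun k => phi_c h (g k)).
split.
  move=> k; have [bU gU] := Ug k; split; first exact: act_bisection_open.
  exact: Cc_on_phi_c.
move=> x; rewrite -(phi_c_sum (U := U)).
- by congr (phi_c h _ x); apply/funext.
- by move=> k; have [[_ []]] := Ug k.
- by move=> k y; have [_ [_ g0 _]] := Ug k; exact: g0.
Qed.

(** By freeness, the unit is the only arrow over [rho t] that fixes [t]. *)
Lemma phi_c_one_free (f : G -> R[i]) (t : units H) : free_actor h ->
  phi_c h f (Defs.one H t) = f (Defs.one G (rho t)).
Proof.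
move=> hfree; rewrite /phi_c src_one -/(rho t).
transitivity (\sum_(g \in [set Defs.one G (rho t)]) f g);
  last by rewrite fsbig_set1.
apply: eq_fsbigl.
apply/seteqP; split => [g [/= sg /esym gt]|g /= ->].
  by rewrite (proj1 (hfree t g sg) gt) sg.
by rewrite src_one act_one.
Qed.

End PhiC.

(* The image of a function on the units under [C_c(units G) -> C_c(G)]. *)
Definition units_extension (G : topGroupoid) (k : units G -> R[i]) (x : G) :
    R[i] :=
  if x \in range (Defs.one G) then k (src x) else 0.

Lemma units_extension_one (G : topGroupoid) (k : units G -> R[i])
    (t : units G) : units_extension k (Defs.one G t) = k t.
Proof. by rewrite /units_extension mem_set ?src_one//; exists t. Qed.

Lemma units_extension_Cc_on (G : topGroupoid) (k : units G -> R[i])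
    (K : set (units G)) : hausdorff_space (units G) ->
  continuous (k : units G -> R[i]^o) -> compact K ->
  (forall t, ~ K t -> k t = 0) ->
  Cc_on (range (Defs.one G)) (units_extension k).
Proof.
move=> hsG ck cK k0; apply: (@Cc_onP _ _ (Defs.one G @` K)) => //.
- by move=> x y; rewrite !inE => -[t _ <-] [u _ <-]; rewrite !src_one => ->.
- apply: (@subspace_eq_continuous _ _ _ (k \o @src G : G -> R[i]^o)).
    by move=> x x1; rewrite /from_subspace /units_extension x1.
  apply: continuous_subspaceT => x; apply: continuous_comp; last exact: ck.
  exact: src_continuous.
- apply: continuous_compact => //.
  by apply: continuous_subspaceT; exact: one_continuous.
- by move=> _ [t _ <-]; exists t.
- move=> x Kx; rewrite /units_extension; case: ifPn => //; rewrite inE.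
  by move=> [t _ tx]; apply: k0; rewrite -tx src_one => Kt; apply: Kx; exists t.
Qed.

(** A unit arrow fixes [src x], so it contributes at [x] only when [x] is a unit. On functions
    carried by the units, [phi_c] is thus composition with the anchor map. *)
Lemma phi_c_units_extension (G H : topGroupoid) (h : actor G H)
    (k : units G -> R[i]) :
  phi_c h (units_extension k) =
  units_extension (fun t => k (anchor h (Defs.one H t))).
Proof.
apply/funext => x; set u := anchor h (Defs.one H (src x)).
have supp (y : G) : [set g | src g = u /\ x = act h g (Defs.one H (src x))] y ->
    y \in range (Defs.one G) -> y = Defs.one G u /\ x = Defs.one H (src x).
  move=> [sy xy]; rewrite inE => -[v _ vy].
  have ey : y = Defs.one G u by rewrite -sy -vy src_one.
  by split => //; rewrite {1}xy ey act_one.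
rewrite /phi_c [RHS]/units_extension; case: ifPn => [|x1].
  rewrite inE => -[t _ tx]; have xE : x = Defs.one H (src x).
    by rewrite -tx src_one.
  transitivity (\sum_(g \in [set Defs.one G u]) units_extension k g);
    last by rewrite fsbig_set1 units_extension_one.
  apply/esym/fsbig_widen => [y /= ->|g [gP /= g1]].
    by rewrite src_one; split => //; rewrite act_one.
  by rewrite /units_extension; case: ifPn => // /(supp _ gP)[].
apply: fsbig1 => g gP; rewrite /units_extension; case: ifPn => //.
move=> /(supp _ gP)[_ xE]; move: x1; rewrite notin_setE; case.
by exists (src x).
Qed.

(** * Compactly supported functions on a Hausdorff groupoid *)

Section Hausdorff.
Variable G : topGroupoid.
Hypothesis hausG : hausdorff_space G.

(** The compact support of each [g k] is closed in a Hausdorff space, so [g k] vanishes near every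
    point outside it and the extension by zero stays continuous. *)
Lemma Cc_continuous_compact (f : G -> R[i]) : Cc f ->
  continuous (f : G -> R[i]^o) /\
  exists2 K : set G, compact K & forall x, ~ K x -> f x = 0.
Proof.
move=> [n [U [c [g [Ug fE]]]]].
pose K k := U k `&` closure [set x | g k x != 0].
have cK k : compact (K k) by have [_ []] := Ug k.
have gK k x : ~ K k x -> g k x = 0.
  have [_ [_ g0 _]] := Ug k; move=> Kx; apply: contrapT => /eqP gx; apply: Kx.
  split; last exact: subset_closure.
  by apply: contrapT => /g0/eqP; rewrite (negbTE gx).
have cg k : continuous (g k : G -> R[i]^o).
  move=> x; have [[oU _] [cg g0 _]] := Ug k.
  have [Kx|Kx] := pselect (K k x).
    by move: cg; rewrite continuous_open_subspace//; apply; rewrite inE;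
      case: Kx.
  have ox : nbhs x (~` K k).
    by apply: open_nbhs_nbhs; split => //; apply: closed_openC;
      exact: compact_closed.
  rewrite /continuous_at gK// => V /nbhs_singleton V0.
  by apply: filterS ox => y /gK /= ->.
split.
  have -> : f = \sum_(k < n) (fun x => c k * g k x).
    by apply/funext => x; rewrite fE fct_sumE.
  move=> x; elim/big_ind : _ => [|f1 f2|k _]; first exact: cst_continuous.
    by move=> c1 c2; exact: (@cvgD _ R[i]^o _ _ _ f1 f2 _ _ c1 c2).
  by apply: (@continuousM R[i] _ (cst (c k)));
    [exact: cst_continuous|exact: cg].
exists (\big[setU/set0]_(k < n) K k).
  by apply: bigsetU_compact => k _.
move=> x Kx; rewrite fE big1// => k _; rewrite gK ?mulr0// => Kkx.
by apply: Kx; rewrite -bigcup_seq; exists k; rewrite //= mem_index_enum.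
Qed.

Lemma Cc_comp_one (f : G -> R[i]) : Cc f ->
  continuous (fun t => f (Defs.one G t) : R[i]^o) /\
  exists2 K : set (units G), compact K &
    forall t, ~ K t -> f (Defs.one G t) = 0.
Proof.
move=> /Cc_continuous_compact[cf [K cK fK]]; split.
  move=> t; apply: (@continuous_comp _ _ _ (Defs.one G) (f : G -> R[i]^o)).
    exact: one_continuous.
  exact: cf.
exists (@src G @` (K `&` range (Defs.one G))).
  apply: continuous_compact.
    by apply: continuous_subspaceT; exact: src_continuous.
  by apply: compact_closedI => //; exact: closed_range_one.
move=> t Kt; apply: fK => K1; apply: Kt.
by exists (Defs.one G t); rewrite ?src_one.
Qed.

End Hausdorff.

End Cc.

(** * Norm estimates and limits in the complex scalars *)

Section ComplexNorm.
Variable R : realType.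

Lemma gt0_complexP (e : R[i]) : 0 < e -> exists2 r : R, 0 < r & e = r%:C.
Proof. by case: e => a b; rewrite ltcE /= => /andP[/eqP -> a0]; exists a. Qed.

Lemma norm_real_complex (x : R) : `|x%:C| = `|x|%:C.
Proof. by rewrite normc_def /= expr0n addr0 sqrtr_sqr. Qed.

Lemma Re_normE (z : R[i]) : (complex.Re `|z|)%:C = `|z|.
Proof. by rewrite RRe_real// normr_real. Qed.

Lemma real_complex_continuous : continuous (fun x : R => x%:C : R[i]^o).
Proof.
move=> x; apply/cvgrPdist_lt => _ /gt0_complexP[e e0 ->]; near=> y.
rewrite -rmorphB norm_real_complex ltcR.
by near: y; apply: cvgr_dist_lt.
Unshelve. all: end_near. Qed.

Lemma Re_norm_continuous : continuous (fun z : R[i]^o => complex.Re `|z|).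
Proof.
move=> z; apply/(@cvgrPdist_lt _ R^o _ (nbhs (z : R[i]^o))) => e e0; near=> w.
rewrite -ltcR -norm_real_complex rmorphB /= !Re_normE.
apply: (le_lt_trans (ler_dist_dist _ _)).
by near: w; apply: (@cvgr_dist_lt _ R[i]^o); rewrite ?ltcR.
Unshelve. all: end_near. Qed.

Lemma closed_norm_le (X : topologicalType) (f : X -> R[i]) (e : R) :
  continuous (f : X -> R[i]^o) -> closed [set x | `|f x| <= e%:C].
Proof.
move=> cf; have -> : [set x | `|f x| <= e%:C] =
    (fun x => complex.Re `|f x|) @^-1` [set r | r <= e].
  by apply/seteqP; split => x; rewrite /= -[`|f x|]Re_normE lecR.
apply: closed_comp => [x _|]; last exact: closed_le.
by apply: (@continuous_comp _ R[i]^o); [exact: cf|exact: Re_norm_continuous].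
Qed.

Lemma closed_norm_ge (X : topologicalType) (f : X -> R[i]) (e : R) :
  continuous (f : X -> R[i]^o) -> closed [set x | e%:C <= `|f x|].
Proof.
move=> cf; have -> : [set x | e%:C <= `|f x|] =
    (fun x => complex.Re `|f x|) @^-1` [set r | e <= r].
  by apply/seteqP; split => x; rewrite /= -[`|f x|]Re_normE lecR.
apply: closed_comp => [x _|]; last exact: closed_ge.
by apply: (@continuous_comp _ R[i]^o); [exact: cf|exact: Re_norm_continuous].
Qed.

Lemma norm_le_ReIm (z : R[i]) (e : R) :
  `|complex.Re z| <= e -> `|complex.Im z| <= e -> `|z| <= (e *+ 2)%:C.
Proof.
move=> re im; rewrite [z]complexE (le_trans (ler_normD _ _))// mulr2n rmorphD.
by rewrite lerD// ?normrM !norm_real_complex/= ?normCi ?mul1r lecR.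
Qed.

(* [sup_n (a n - e n)] is the limit: the hypothesis says that every [a n - e n]
   is below every [a m + e m]. *)
Lemma real_limit (a e : nat -> R) :
  (forall n m, `|a n - a m| <= e n + e m) ->
  exists l : R, forall n, `|l - a n| <= e n.
Proof.
move=> ae; set S := range (fun n => a n - e n).
have ub m : ubound S (a m + e m).
  by move=> _ [n _ <-]; have := ae n m; rewrite ler_norml => /andP[_]; lra.
have S0 : S !=set0 by exists (a 0%N - e 0%N); exists 0%N.
exists (sup S) => n; rewrite ler_norml.
have h1 : sup S <= a n + e n by apply: ge_sup.
have h2 : a n - e n <= sup S.
  by apply: ub_le_sup; [exists (a 0%N + e 0%N)|exists n].
by apply/andP; split; lra.
Qed.

Lemma complex_limit (z : nat -> R[i]) (e : nat -> R) :
  (forall n m, `|z n - z m| <= (e n + e m)%:C) ->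
  exists l : R[i], forall n, `|l - z n| <= (e n *+ 2)%:C.
Proof.
move=> ze.
have [a aP] : exists l : R, forall n, `|l - complex.Re (z n)| <= e n.
  apply: (real_limit (a := fun n => complex.Re (z n))) => n m.
  by rewrite -lecR -raddfB/= (le_trans (normc_ge_Re _))// ze.
have [b bP] : exists l : R, forall n, `|l - complex.Im (z n)| <= e n.
  apply: (real_limit (a := fun n => complex.Im (z n))) => n m.
  rewrite -lecR -raddfB/=; apply: le_trans (ze n m).
  (* Up to sign, the imaginary part is the real part of the product with the imaginary unit, which
     has norm [1]. *)
  rewrite -normrN -ReiNIm (le_trans (normc_ge_Re _))// normrM normCi mulr1//.
exists (Complex a b) => n.
by apply: norm_le_ReIm; rewrite raddfB; [exact: aP|exact: bP].
Qed.

Lemma cvg_uniform_le (X : topologicalType) (f : nat -> X -> R[i])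
    (g : X -> R[i]) :
  (forall e : R, 0 < e ->
     \forall n \near \oo, forall x, `|g x - f n x| <= e%:C) ->
  (fun n => f n : {uniform X -> R[i]^o}) @ \oo --> (g : {uniform X -> R[i]^o}).
Proof.
move=> gf P /uniform_nbhs[E [entE EP]].
move: entE; rewrite -entourage_ballE => -[/= _ /gt0_complexP[e e0 ->] eE].
(* Balls are defined by a strict inequality, hence the half. *)
have e20 : 0 < e / 2 by rewrite divr_gt0.
near_simpl; apply: filterS (gf _ e20) => n gn; apply: EP => x _; apply: eE.
rewrite /= -ball_normE /=.
apply: (@le_lt_trans _ _ (e / 2)%:C); last by rewrite ltcR; lra.
exact: gn.
Qed.

End ComplexNorm.

(** * Distances and limits in the local multiplier algebra *)

Section LocalMultiplier.
Variables (R : realType) (X : topologicalType).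

Lemma meagre_bigcup (F : nat -> set X) : (forall n, meagre (F n)) ->
  meagre (\bigcup_n F n).
Proof.
move=> /choice[K KP].
(* Pairs of indices are coded by naturals; an index that codes no pair gets [set0]. *)
exists (fun m => if unpickle m is Some nk then K nk.1 nk.2 else set0).
split=> [m|].
  case: unpickle => [nk|]; first exact: (proj1 (KP nk.1)).
  by rewrite /nowhere_dense closure0 interior0.
apply/seteqP; split => x [n _].
  rewrite (proj2 (KP n)) => -[k _ Kx].
  by exists (pickle (n, k)) => //; rewrite pickleK.
case: unpickle => // nk Kx; exists nk.1 => //.
by rewrite (proj2 (KP nk.1)); exists nk.2.
Qed.

Lemma mloc_classP (f g : bborel R X) :
  mloc_class f = mloc_class g <->
  vanishes_comeagrely (fun x => val f x - val g x).
Proof. by split => [/eqmodP/asboolP|fg] //; apply/eqmodP/asboolP. Qed.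

Lemma mloc_class_surj (c : Mloc R X) : exists f : bborel R X, mloc_class f = c.
Proof. by exists (repr c); rewrite /mloc_class reprK. Qed.

Lemma mloc_dist_lt (c d : Mloc R X) (e : R) : mloc_dist c d < e ->
  exists f g : bborel R X, [/\ mloc_class f = c, mloc_class g = d &
    forall x, `|val f x - val g x| <= e%:C].
Proof.
move=> /inf_lt[].
  (* The set under the infimum has to be nonempty. Bounds of two representatives supply an element;
     absolute values are taken since [M] and [N] could be negative when [X] is empty. *)
  have [f fc] := mloc_class_surj c; have [g gd] := mloc_class_surj d.
  have /set_mem[_ [M fM]] := valP f; have /set_mem[_ [N gN]] := valP g.
  exists (`|M| + `|N|); split; first by rewrite addr_ge0.
  exists f, g; split => // x; rewrite (le_trans (ler_normB _ _))// rmorphD.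
  rewrite lerD//; [apply: le_trans (fM x) _|apply: le_trans (gN x) _];
    by rewrite lecR ler_norm.
move=> M [M0 [f [g [fc gd fg]]]] Me; exists f, g; split => // x.
by rewrite (le_trans (fg x))// lecR ltW.
Qed.

(** Some representatives satisfy the estimate everywhere; the given ones agree with them on comeagre
    sets. *)
Lemma mloc_dist_comeagre (c d : Mloc R X) (e : R) (f g : bborel R X) :
  mloc_dist c d < e -> mloc_class f = c -> mloc_class g = d ->
  exists2 A, comeagre A & forall x, A x -> `|val f x - val g x| <= e%:C.
Proof.
move=> /mloc_dist_lt[f' [g' [<- <- fg']]] /mloc_classP[A cA fA].
move=> /mloc_classP[B cB gB]; exists (A `&` B).
  by rewrite /comeagre setCI; exact: meagreU.
move=> x [/fA/subr0_eq -> /gB/subr0_eq ->]; exact: fg'.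
Qed.

(** A representative of [c] is within [2 / (n + 1)] of [k] on a comeagre set [A n]. The intersection
    of all [A n] is still comeagre, and there the two functions are equal. *)
Lemma mloc_class_limit (k : X -> R[i]) (c : Mloc R X) : bounded_borel k ->
  (forall e : R, 0 < e -> exists (k' : X -> R[i]) (d : Mloc R X),
     [/\ is_class_of k' d, mloc_dist c d < e &
         forall x, `|k x - k' x| <= e%:C]) ->
  is_class_of k c.
Proof.
move=> bk kc; have [b bc] := mloc_class_surj c.
exists (exist _ k (mem_set bk)) => //; rewrite -bc; apply/mloc_classP.
have close n : exists A, comeagre A /\
    forall x, A x -> `|val b x - k x| <= (n.+1%:R^-1 *+ 2)%:C.
  have [//|k' [d [[b' b'k dE] cd kk']]] := kc n.+1%:R^-1.
  have [A cA bA] := mloc_dist_comeagre cd bc (esym dE).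
  exists A; split => // x Ax.
  rewrite -(subrK (k' x) (val b x)) -addrA mulr2n rmorphD.
  rewrite (le_trans (ler_normD _ _))// lerD//; first by rewrite -b'k bA.
  by rewrite distrC.
have [A AP] := choice close.
exists (\bigcap_n A n).
  rewrite /comeagre setC_bigcap; apply: meagre_bigcup => n.
  by have [] := AP n.
move=> x Ax /=; apply/eqP; rewrite -normr_eq0 -Re_normE.
suff -> : complex.Re `|val b x - k x| = 0 by [].
apply/eqP; rewrite eq_le -!lecR Re_normE normr_ge0 andbT lecR.
apply/ler_addgt0Pr => e e0; rewrite add0r.
have e2 : 0 < e / 2 by rewrite divr_gt0.
have [n _ /(_ n (leqnn n)) ne] := near_infty_natSinv_lt (PosNum e2).
have {}ne : n.+1%:R^-1 < e / 2 := ne.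
apply: (@le_trans _ _ (n.+1%:R^-1 *+ 2)); last first.
  by rewrite mulr2n [leRHS]splitr lerD// ltW.
rewrite -lecR Re_normE.
by have [_] := AP n; apply; exact: Ax.
Qed.

Hypotheses (hsX : hausdorff_space X) (lcX : locally_compact [set: X]).

(** The inequality fails on an open set contained in the meagre complement of [A]; by Baire that set
    is empty. *)
Lemma comeagre_norm_le (f g : X -> R[i]) (e : R) (A : set X) :
  continuous (f : X -> R[i]^o) -> continuous (g : X -> R[i]^o) -> comeagre A ->
  (forall x, A x -> `|f x - g x| <= e%:C) -> forall x, `|f x - g x| <= e%:C.
Proof.
move=> cf cg cA fgA x; apply: contrapT => fgx.
have cfg : continuous (fun y => f y - g y : R[i]^o).
  by move=> y; apply: (@continuousB _ R[i]^o _ (f : X -> R[i]^o) g);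
    [exact: cf|exact: cg].
have := closed_openC (closed_norm_le (e := e) cfg).
move=> /(lch_baire hsX lcX cA); apply; first by exists x.
by move=> y fgy Ay; apply: fgy; exact: fgA.
Qed.

(** Both functions are compared with one representative of [b] on a comeagre set, and continuity
    removes the exceptional set. Distances in [Mloc] thus control uniform distances. *)
Lemma is_class_of_continuous_close (f g : X -> R[i]) (c d b : Mloc R X)
    (e1 e2 : R) :
  continuous (f : X -> R[i]^o) -> continuous (g : X -> R[i]^o) ->
  is_class_of f c -> is_class_of g d ->
  mloc_dist b c < e1 -> mloc_dist b d < e2 ->
  forall x, `|f x - g x| <= (e1 + e2)%:C.
Proof.
move=> cf cg [f' f'E fc] [g' g'E gd] bc bd.
have [b' b'E] := mloc_class_surj b.
have [A cA fA] := mloc_dist_comeagre bc b'E (esym fc).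
have [B cB gB] := mloc_dist_comeagre bd b'E (esym gd).
apply: (@comeagre_norm_le _ _ _ (A `&` B)) => //.
  by rewrite /comeagre setCI; exact: meagreU.
move=> x [Ax Bx]; rewrite -f'E -g'E -(subrK (val b' x) (val f' x)) -addrA.
rewrite rmorphD (le_trans (ler_normD _ _))// lerD ?gB// distrC; exact: fA.
Qed.

Lemma is_class_of_continuous_inj (f g : X -> R[i]) (c : Mloc R X) :
  continuous (f : X -> R[i]^o) -> continuous (g : X -> R[i]^o) ->
  is_class_of f c -> is_class_of g c -> f = g.
Proof.
move=> cf cg [f' f'E ->] [g' g'E] /mloc_classP[A cA fgA].
apply/funext => x; apply/eqP; rewrite -subr_eq0 -normr_le0.
apply: (@comeagre_norm_le _ _ 0 A) => // y Ay.
by rewrite -f'E -g'E fgA// normr0.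
Qed.

End LocalMultiplier.

(** * Functions vanishing at infinity *)

Section C0Functions.
Variable R : realType.

Lemma C0_compact_support (X : topologicalType) (f : X -> R[i]) (K : set X) :
  continuous (f : X -> R[i]^o) -> compact K -> (forall x, ~ K x -> f x = 0) ->
  C0 f.
Proof.
move=> cf cK fK; split => // e e0.
apply: (subclosed_compact _ cK); first exact: closed_norm_ge.
move=> x /= ex; apply: contrapT => /fK f0.
by move: ex; rewrite f0 normr0 lecR leNgt e0.
Qed.

Lemma C0_proper_comp (X Y : topologicalType) (p : X -> Y) (g : Y -> R[i]) :
  proper_map p -> C0 g -> C0 (fun x => g (p x)).
Proof.
move=> [cp pK] [cg gK]; split; last by move=> e /gK/pK.
by move=> x; apply: (@continuous_comp _ _ _ p (g : Y -> R[i]^o));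
  [exact: cp|exact: cg].
Qed.

(** When [f n] is within [e / 2] of [g], the closed set where the norm of [g] is at least [e] lies
    in the compact set where that of [f n] is at least [e / 2]. *)
Lemma C0_uniform_limit (X : topologicalType) (f : nat -> X -> R[i])
    (g : X -> R[i]) : (forall n, C0 (f n)) ->
  (forall e : R, 0 < e ->
     \forall n \near \oo, forall x, `|g x - f n x| <= e%:C) ->
  C0 g.
Proof.
move=> f0 fg; have cg : continuous (g : X -> R[i]^o).
  apply: (@uniform_limit_continuous X R[i]^o
    ((fun n => f n : {uniform X -> R[i]^o}) @ \oo)).
    by exists 0%N => // n _; exact: (proj1 (f0 n)).
  exact: cvg_uniform_le.
split => // e e0; have e2 : 0 < e / 2 by rewrite divr_gt0.
have [n _ /(_ n (leqnn n)) gfn] := fg _ e2.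
apply: (subclosed_compact _ (proj2 (f0 n) _ e2)); first exact: closed_norm_ge.
move=> x /=; rewrite -[`|g x|]Re_normE -[`|f n x|]Re_normE !lecR => ex.
have : complex.Re `|g x| <= e / 2 + complex.Re `|f n x|.
  rewrite -lecR rmorphD /= !Re_normE -{1}(subrK (f n x) (g x)).
  by rewrite (le_trans (ler_normD _ _))// lerD.
by move: ex; lra.
Qed.

Lemma continuous_bounded_borel (X : topologicalType) (f g : X -> R[i]) (e : R) :
  continuous (f : X -> R[i]^o) -> bounded_borel g ->
  (forall x, `|f x - g x| <= e%:C) -> bounded_borel f.
Proof.
move=> cf [_ [M gM]] fg; split.
  move=> V oV; apply: sub_sigma_algebra.
  by apply: (open_comp _ oV) => x _; exact: cf.
exists (e + M) => x; rewrite -(subrK (g x) (f x)) (le_trans (ler_normD _ _))//.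
by rewrite rmorphD lerD.
Qed.

(* The witness is [k] shrunk radially by [e]. *)
Lemma C0_approx (X : topologicalType) (k : X -> R[i]) (e : R) : C0 k -> 0 < e ->
  exists k' : X -> R[i], [/\ continuous (k' : X -> R[i]^o),
    exists2 K : set X, compact K & forall x, ~ K x -> k' x = 0 &
    forall x, `|k x - k' x| <= e%:C].
Proof.
move=> [ck kK] e0.
pose r (x : X) : R := complex.Re `|k x|.
(* The denominator is [r x] wherever the numerator is nonzero; the maximum with [e] keeps it
   positive, so that [w] is continuous. *)
pose w (x : X) : R := Num.max 0 (r x - e) / Num.max (r x) e.
have maxe x : 0 < Num.max (r x) e by rewrite lt_max e0 orbT.
have cr : continuous (r : X -> R^o).
  by move=> x; apply: (@continuous_comp _ R[i]^o);
    [exact: ck|exact: Re_norm_continuous].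
have cw : continuous (w : X -> R).
  move=> x; apply: (@continuousM R X).
    apply: continuous_max; first exact: cst_continuous.
    by apply: continuousB; [exact: cr|exact: cst_continuous].
  apply: continuousV; first by rewrite gt_eqF.
  by apply: continuous_max; [exact: cr|exact: cst_continuous].
exists (fun x => (w x)%:C * k x); split.
- move=> x; apply: (@continuousM R[i] X (fun y => (w y)%:C) k).
    by apply: (@continuous_comp _ _ R[i]^o w);
      [exact: cw|exact: real_complex_continuous].
  exact: ck.
- exists [set x | e%:C <= `|k x|]; first exact: kK.
  move=> x /= /negP; rewrite -Re_normE lecR -ltNge -/(r x) => rxe.
  have -> : w x = 0.
    by rewrite /w (max_idPl _) ?mul0r// subr_le0 ltW.
  by rewrite mul0r.
- move=> x; rewrite -{1}[k x]mul1r -mulrBl -(rmorph1 (real_complex R)) -rmorphB.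
  rewrite normrM norm_real_complex -Re_normE -/(r x) -rmorphM lecR /w.
  have rx0 : 0 <= r x by rewrite -lecR Re_normE normr_ge0.
  have [rxe|erx] := leP (r x) e.
    by rewrite max_l ?subr_le0// mul0r subr0 normr1 mul1r.
  have rx1 : 0 < r x by exact: lt_trans erx.
  rewrite max_r; last by rewrite subr_ge0 ltW.
  have -> : 1 - (r x - e) / r x = e / r x.
    by rewrite mulrBl divff ?gt_eqF// opprB addrC subrK.
  by rewrite ger0_norm ?divfK ?gt_eqF// divr_ge0 ?ltW.
Qed.

End C0Functions.

(** * Density, and the inclusion of [C0] functions into the completion *)

Lemma dense_near (T : topologicalType) (D P : set T) (a : T) : dense D ->
  nbhs a P -> exists2 x, D x & P x.
Proof.
move=> dD aP; have [|x [Px Dx]] := dD (interior P) _ (@open_interior _ P).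
  by exists a.
by exists x => //; exact: interior_subset.
Qed.

Lemma is_class_of_bounded_borel (R : realType) (X : topologicalType)
    (f : X -> R[i]) (c : Mloc R X) : is_class_of f c -> bounded_borel f.
Proof. by move=> [b <- _]; exact: set_mem (valP b). Qed.

(** Continuity of [j] is given only within the [C0] functions; the sequence and its limit stay
    there. *)
Lemma C0_inclusion_cvg (R : realType) (G : topGroupoid) (A : fullCstar R G)
    (j : (units G -> R[i]) -> A) (f : nat -> units G -> R[i])
    (g : units G -> R[i]) :
  is_C0_inclusion j -> (forall n, C0 (f n)) -> C0 g ->
  (forall e : R, 0 < e ->
     \forall n \near \oo, forall x, `|g x - f n x| <= e%:C) ->
  j (f n) @[n --> \oo] --> j g.
Proof.
move=> [/subspace_continuousP cj _] f0 g0 fg.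
apply: cvg_trans (cj g g0) => P /= jP.
have near_f : \forall n \near \oo, C0 (f n) -> P (j (f n)).
  exact: (cvg_uniform_le fg jP).
by apply: filterS near_f => n; apply; exact: f0.
Qed.

Lemma C0_inclusion_iota (R : realType) (G : topGroupoid) (A : fullCstar R G)
    (j : (units G -> R[i]) -> A) (k : units G -> R[i]) (K : set (units G)) :
  hausdorff_space (units G) -> is_C0_inclusion j ->
  continuous (k : units G -> R[i]^o) -> compact K ->
  (forall t, ~ K t -> k t = 0) -> j k = Defs.iota A (units_extension k).
Proof.
move=> hsG [_ hj] ck cK k0.
rewrite -(hj _ (units_extension_Cc_on hsG ck cK k0)); congr j.
by apply/funext => t; rewrite units_extension_one.
Qed.

Lemma Cc0 (R : realType) (G : topGroupoid) : @Cc R G (fun=> 0).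
Proof.
exists 0%N, (fun=> set0), (fun=> 0), (fun=> fun=> 0); split => [[]//|x].
by rewrite big_ord0.
Qed.

Lemma near_infty_invS_le (R : realType) (e : R) : 0 < e ->
  \forall n \near \oo, n.+1%:R^-1 *+ 2 <= e.
Proof.
move=> e0; have e2 : 0 < e / 2 by rewrite divr_gt0.
apply: filterS (near_infty_natSinv_lt (PosNum e2)) => n ne.
by rewrite mulr2n [leRHS]splitr lerD// ltW.
Qed.

(** * Bump functions on open bisections *)

Section Bump.
Variables (R : realType) (G : topGroupoid).
Hypotheses (etG : etale G) (hsG : hausdorff_space (units G)).
Hypothesis lcG : locally_compact [set: units G].

(** A Urysohn function on the unit space is transported to [U] along [src]; its support lies in the
    section image of the compact [closure V]. *)
Lemma Cc_on_bump (U : set G) (x : G) : open_bisection U -> U x ->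
  exists2 f : G -> R[i], Cc_on U f & f x = 1.
Proof.
move=> [oU [injU _]] Ux; have Ut : (@src G @` U) (src x) by exists x.
have [V [oV Vt VU] cV] := lch_compact_nbhs hsG lcG (etale_src_open etG oU) Ut.
have /(@uniform_separatorP _ R)[u [cu _ u0 u1]] :
    uniform_separator [set src x] (~` V).
  apply: (locally_compact_completely_regular (R := R) lcG hsG).
    exact: open_closedC.
  exact.
(* The separating function [u] is [0] at [src x] and [1] off [V], hence the complement. *)
pose w (t : units G) : R[i] := (1 - u t)%:C.
have cw : continuous (w : units G -> R[i]^o).
  move=> t; apply: (@continuous_comp _ _ _ (fun y => 1 - u y)
    (fun y : R => y%:C : R[i]^o)); last exact: real_complex_continuous.
  by apply: (@continuousB R R^o); [exact: cst_continuous|exact: cu].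
exists (fun y => if y \in U then w (src y) else 0); last first.
  by rewrite mem_set// /w [u _](u0 _ _) ?subr0//; exists (src x).
apply: (@Cc_onP _ _ _ (src_section U @` closure V)) => //.
- apply: (@subspace_eq_continuous _ _ _ (w \o @src G : G -> R[i]^o)).
    by move=> y yU; rewrite /from_subspace yU.
  apply: continuous_subspaceT => y; apply: continuous_comp; last exact: cw.
  exact: src_continuous.
- apply: continuous_compact => //.
  apply: continuous_in_subspaceT => t; rewrite inE => /VU Vs.
  exact: src_section_continuous.
- by move=> _ [t /VU Vs <-]; have [] := src_sectionP Vs.
- move=> y Ly; case: ifPn => //; rewrite inE => Uy.
  rewrite /w [u _](u1 _ _) ?subrr//; exists (src y) => // Vy.
  by apply: Ly; exists (src y); [exact: subset_closure|exact: src_sectionK].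
Qed.

End Bump.

(** * Stable sets, freeness and entwining of expectations *)

Section Entwining.
Variables (R : realType) (G H : topGroupoid).
Hypotheses (etG : etale G) (hsG : hausdorff_space (units G)).
Hypothesis lcG : locally_compact [set: units G].
Hypotheses (etH : etale H) (hsH : hausdorff_space (units H)).
Hypothesis lcH : locally_compact [set: units H].
Variable h : actor G H.
Hypotheses (hproper : proper_actor h) (hausG : hausdorff_space G).

Let rho (t : units H) : units G := anchor h (Defs.one H t).

Lemma stable_set_meagre_eq0 (U : set G) : open_bisection U ->
  (forall V : set (units H), open V -> precompact V ->
     meagre (stable_set h U `&` V)) <-> stable_set h U = set0.
Proof.
move=> bU; split=> [mU|-> V _ _]; last by rewrite set0I; exact: meagre0.
rewrite -subset0 => t St.
have oS := stable_set_open h etG etH hausG bU.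
have [V [oV Vt _] cV] := lch_compact_nbhs hsH lcH oS St.
have pV : precompact V by rewrite precompactE.
apply: (lch_baire hsH lcH (mU V oV pV) (openI oS oV)); first by exists t.
by [].
Qed.

Lemma stable_sets_eq0_free :
  (forall U : set G, bisection U -> stable_set h U = set0) <-> free_actor h.
Proof.
split=> [S0 t g sg|hfree U _]; last first.
  rewrite -subset0 => t [g [_ g1 sg /(proj1 (hfree t g sg)) ge]].
  by apply: g1; exists (src g).
split=> [gt|->]; last by rewrite sg act_one.
apply: contrapT => ge.
(* Bisections need not be open here, so a single arrow forms one. *)
have bg : bisection [set g] by split=> x y; rewrite !inE => -> ->.
have : stable_set h [set g] t.
  exists g; split => // -[u _ ug]; apply: ge.
  by rewrite -ug src_one.
by rewrite S0.
Qed.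

Variables (A : fullCstar R G) (B : fullCstar R H) (phi : A -> B).
Variables (jA : (units G -> R[i]) -> A) (jB : (units H -> R[i]) -> B).
Variables (ELA : A -> Mloc R (units G)) (ELB : B -> Mloc R (units H)).
Hypotheses (hphi : is_induced_hom h phi).
Hypotheses (hjA : is_C0_inclusion jA) (hjB : is_C0_inclusion jB).
Hypotheses (hELA : is_local_expectation ELA) (hELB : is_local_expectation ELB).

(* [ELB] detects [C_0(units H)], so the inclusion [jB] has trivial kernel. *)
Lemma C0_inclusion_eq0 (k : units H -> R[i]) : C0 k ->
  jB k = Defs.iota B (fun=> 0) -> k = fun=> 0.
Proof.
move=> k0 jk.
(* That [k] represents [ELB (jB k)] is not given directly, as the expectation is prescribed on [Cc]
   only; hence the compactly supported approximants. *)
have /choice[kn knP] : forall n : nat, exists k' : units H -> R[i],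
    [/\ continuous (k' : units H -> R[i]^o),
      exists2 K : set (units H), compact K & forall x, ~ K x -> k' x = 0 &
      forall x, `|k x - k' x| <= (n.+1%:R^-1 : R)%:C].
  by move=> n; apply: C0_approx.
have kk (e : R) : 0 < e ->
    \forall n \near \oo, forall x, `|k x - kn n x| <= e%:C.
  move=> e0; apply: filterS (near_infty_invS_le e0) => n ne x.
  have [_ _ /(_ x) kx] := knP n; rewrite (le_trans kx)// lecR.
  by rewrite (le_trans _ ne)// mulr2n lerDl.
have kn0 n : C0 (kn n).
  by have [ck [K cK K0] _] := knP n; exact: C0_compact_support ck cK K0.
have cj := C0_inclusion_cvg hjB kn0 k0 kk.
apply/funext => x; apply/eqP; rewrite -normr_eq0 -Re_normE.
suff -> : complex.Re `|k x| = 0 by [].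
apply/eqP; rewrite eq_le -!lecR Re_normE normr_ge0 andbT lecR.
apply/ler_addgt0Pr => e e0; rewrite add0r.
(* One third bounds [k - kn n]. The other two bound [kn n]: they come from the distances of
   [ELB (jB k)] to itself, represented by [0], and to [ELB (jB (kn n))]. *)
have e3 : 0 < e / 3 by rewrite divr_gt0.
have nearE := proj1 hELB (jB k) _ e3.
have nE' :
    \forall n \near \oo, mloc_dist (ELB (jB k)) (ELB (jB (kn n))) < e / 3.
  exact: cj nearE.
have [n [nE nk]] := filter_ex (filterI nE' (kk _ e3)).
have [ck [K cK K0] _] := knP n.
have jkn : jB (kn n) = Defs.iota B (units_extension (kn n)).
  exact: C0_inclusion_iota hsH hjB ck cK K0.
have ccn : Cc (units_extension (kn n)).
  apply: Cc_on_Cc (range_one_bisection etH) _.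
  exact: (units_extension_Cc_on hsH ck cK).
have cls : is_class_of (kn n) (ELB (jB (kn n))).
  rewrite jkn; have := proj2 hELB _ ccn; congr is_class_of.
  by apply/funext => t; rewrite units_extension_one.
have cls0 : is_class_of (fun=> 0) (ELB (jB k)).
  by rewrite jk; exact: (proj2 hELB _ (@Cc0 R H)).
have knx := is_class_of_continuous_close hsH lcH (@cst_continuous _ _ 0) ck
  cls0 cls (nbhs_singleton nearE) nE x.
rewrite -lecR Re_normE -(subrK (kn n x) (k x)) (le_trans (ler_normD _ _))//.
have -> : e = e / 3 + (e / 3 + e / 3) by lra.
by rewrite rmorphD lerD ?nk// -normrN -sub0r.
Qed.

Lemma entwines_free : entwines phi jA jB ELA ELB -> free_actor h.
Proof.
move=> ent t g sg; split=> [gt|->]; last by rewrite sg act_one.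
apply: contrapT => ge.
have g1 : ~ range (Defs.one G) g.
  by move=> [u _ ug]; apply: ge; rewrite -ug src_one.
have [U [bU Ug U1]] := open_bisection_basis etG
  (closed_openC (closed_range_one hausG)) g1.
have [oU [injU _]] := bU.
have [f fU fg] := Cc_on_bump R etG hsG lcG bU Ug.
have [cf f0 _] := fU; have ccf := Cc_on_Cc bU fU.
have [k1 [k [k10 k1cls k0 jBk kcls]]] := ent (Defs.iota A f).
(* [f] vanishes on the units, and a class has at most one continuous representative. *)
have k1E : k1 = fun=> 0.
  apply: (is_class_of_continuous_inj hsG lcG (proj1 k10) _ k1cls).
    exact: cst_continuous.
  have := proj2 hELA f ccf; congr is_class_of; apply/funext => u.
  by apply: f0 => /U1; apply; exists u.
have kE : k = fun=> 0.
  apply: C0_inclusion_eq0 => //; rewrite jBk k1E.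
  have -> : jA (fun=> 0) = Defs.iota A (fun=> 0).
    apply: (proj2 hjA (fun=> 0)); apply: (@Cc_onP _ _ _ set0) => //.
    - by have [_ []] := range_one_bisection etG.
    - by apply: continuous_subspaceT; exact: cst_continuous.
    - exact: compact0.
  rewrite (proj2 hphi); last exact: Cc0.
  congr (Defs.iota B _); apply/funext => x.
  by rewrite /phi_c fsbig1.
have : is_class_of (fun u => phi_c h f (Defs.one H u))
    (ELB (phi (Defs.iota A f))).
  by rewrite (proj2 hphi)//; apply: (proj2 hELB); exact: Cc_phi_c.
move=> [b bE bcls]; have [b' b'E b'cls] := kcls.
have [D cD D0] : vanishes_comeagrely (fun u => val b' u - val b u).
  by apply/mloc_classP; rewrite -b'cls -bcls.
have St : stable_set h U t by exists g.
(* For [u] in [N], the arrow of [U] over [rho u] fixes [u] and [f] is nonzero there, so [phi_c h f]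
   is nonzero at the unit [u]. By Baire the interior of [N] meets [D], where [phi_c h f] agrees with
   [k] on units, that is vanishes. *)
pose N := stable_set h U `&`
  [set u | f (src_section U (rho u)) != 0].
have cfs : {for t, continuous (fun u => f (src_section U (rho u)) : R[i]^o)}.
  have Ut : (@src G @` U) (rho t) by exists g.
  apply: (@continuous_comp _ _ _ rho
    (fun u => f (src_section U u) : R[i]^o)).
    exact: unit_anchor_continuous.
  apply: (@continuous_comp _ _ _ (src_section U) (f : G -> R[i]^o)).
    exact: src_section_continuous.
  move: cf; rewrite continuous_open_subspace//; apply.
  by rewrite inE; have [] := src_sectionP Ut.
have Nt : nbhs t N.
  apply: filterI.
    by apply: open_nbhs_nbhs; split => //; exact: stable_set_open.
  apply: (cfs [set z : R[i]^o | z != 0]).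
  have -> : src_section U (rho t) = g by rewrite -(src_sectionK injU Ug) sg.
  rewrite fg; apply: open_nbhs_nbhs; split.
    have -> : [set z : R[i]^o | z != 0] = ~` [set 0].
      by apply/seteqP; split => z /eqP.
    apply: closed_openC; apply: accessible_closed_set1.
    by apply: hausdorff_accessible; exact: norm_hausdorff.
  by rewrite /= oner_neq0.
apply: (lch_baire hsH lcH cD (@open_interior _ N)); first by exists t.
move=> u /interior_subset[[g' [Ug' _ sg' gu]] fu] Du.
move: (D0 u Du); rewrite b'E bE kE sub0r => /eqP; rewrite oppr_eq0.
rewrite (phi_cE h _ injU)// mem_set ?src_one ?(negbTE fu)//.
exists u; first by exists g'.
by rewrite /act_section -sg' src_sectionK.
Qed.

Lemma free_entwines : free_actor h -> entwines phi jA jB ELA ELB.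
Proof.
move=> hfree a; pose e_ n : R := n.+1%:R^-1.
(* Continuity of [ELA] and of [ELB] after [phi] lets one approximant serve both expectations. *)
have /choice[f fP] : forall n, exists f : G -> R[i], [/\ Cc f,
    mloc_dist (ELA a) (ELA (Defs.iota A f)) < e_ n &
    mloc_dist (ELB (phi a)) (ELB (phi (Defs.iota A f))) < e_ n].
  move=> n; have e0 : 0 < e_ n by rewrite invr_gt0.
  have nB := proj1 hphi a _ (proj1 hELB (phi a) _ e0).
  have [_ [f cf <-] [fA fB]] := dense_near (@iota_dense _ _ A)
    (filterI (proj1 hELA a _ e0) nB).
  by exists f.
have cf n : Cc (f n) by have [] := fP n.
pose u n (t : units G) := f n (Defs.one G t).
have cu n : continuous (u n : units G -> R[i]^o).
  have [c _] := Cc_comp_one hausG (cf n); exact: c.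
have u_cls n : is_class_of (u n) (ELA (Defs.iota A (f n))).
  exact: (proj2 hELA).
have urho_cls n :
    is_class_of (fun t => u n (rho t)) (ELB (phi (Defs.iota A (f n)))).
  rewrite (proj2 hphi)//.
  have := proj2 hELB _ (Cc_phi_c etG etH hsH hproper (cf n)).
  congr is_class_of; apply/funext => t; exact: phi_c_one_free.
have uu n m t : `|u n t - u m t| <= (e_ n + e_ m)%:C.
  have [_ dn _] := fP n; have [_ dm _] := fP m.
  exact: (is_class_of_continuous_close hsG lcG (cu n) (cu m) (u_cls n)
    (u_cls m) dn dm t).
(* The error doubles because real and imaginary parts converge separately. *)
have /choice[g gP] : forall t, exists l : R[i], forall n,
    `|l - u n t| <= (e_ n *+ 2)%:C.
  by move=> t; apply: (complex_limit (z := fun n => u n t)) => n m.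
have gu (e : R) : 0 < e ->
    \forall n \near \oo, forall t, `|g t - u n t| <= e%:C.
  move=> e0; apply: filterS (near_infty_invS_le e0) => n ne t.
  by rewrite (le_trans (gP t n))// lecR.
have u0 n : C0 (u n).
  have [_ [K cK uK]] := Cc_comp_one hausG (cf n).
  exact: C0_compact_support (cu n) cK uK.
have g0 := C0_uniform_limit u0 gu.
have urho0 n := C0_proper_comp hproper (u0 n).
have grho0 := C0_proper_comp hproper g0.
have grhou (e : R) : 0 < e ->
    \forall n \near \oo, forall t, `|g (rho t) - u n (rho t)| <= e%:C.
  by move=> /gu; apply: filterS => n gn t.
(* The same limiting argument serves [g] on the units of [G] and [g \o rho] on those of [H]. *)
have limit (X : topologicalType) (c : Mloc R X) (k : X -> R[i]) kn d :
    bounded_borel k -> (forall n, is_class_of (kn n) (d n)) ->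
    (forall n, mloc_dist c (d n) < e_ n) ->
    (forall e : R, 0 < e ->
       \forall n \near \oo, forall t, `|k t - kn n t| <= e%:C) ->
    is_class_of k c.
  move=> bk kd cd kkn; apply: mloc_class_limit => // e e0.
  have [n [ne kne]] := filter_ex (filterI (near_infty_invS_le e0) (kkn e e0)).
  exists (kn n), (d n); split => //; apply: (lt_le_trans (cd n)).
  by rewrite (le_trans _ ne)// mulr2n lerDl invr_ge0.
exists g, (fun t => g (rho t)); split => //.
- apply: (limit _ _ _ u (fun n => ELA (Defs.iota A (f n)))) => //.
    apply: (continuous_bounded_borel (proj1 g0)
      (is_class_of_bounded_borel (u_cls 0%N))) => t; exact: gP.
  by move=> n; have [] := fP n.
(* [phi (jA g)] and the image under [jB] of [g \o rho] are limits of the same sequence: for the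
   compactly supported [u n] the two sides agree by [phi_c_units_extension]. *)
- have uA n : jA (u n) = Defs.iota A (units_extension (u n)).
    have [_ [K cK uK]] := Cc_comp_one hausG (cf n).
    exact: C0_inclusion_iota hsG hjA (cu n) cK uK.
  have uB n : phi (jA (u n)) = jB (fun t => u n (rho t)).
    have [_ [K cK uK]] := Cc_comp_one hausG (cf n).
    have cE : Cc (units_extension (u n)).
      apply: Cc_on_Cc (range_one_bisection etG) _.
      exact: (units_extension_Cc_on hsG (cu n) cK uK).
    rewrite uA (proj2 hphi)// phi_c_units_extension; apply/esym.
    apply: (C0_inclusion_iota hsH hjB (proj1 (urho0 n)) (proj2 hproper _ cK)).
    by move=> t; exact: uK.
  have c1 := C0_inclusion_cvg hjA u0 g0 gu.
  have c2 := C0_inclusion_cvg hjB urho0 grho0 grhou.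
  apply: (cvg_unique (@norm_hausdorff _ B) c2).
  have uBE : (fun n => jB (fun t => u n (rho t))) = phi \o (fun n => jA (u n)).
    by apply/funext => n /=; rewrite uB.
  rewrite /= uBE; exact: (cvg_comp _ _ c1 (proj1 hphi (jA g))).
- apply: (limit _ _ _ (fun n t => u n (rho t))
    (fun n => ELB (phi (Defs.iota A (f n))))) => //.
    apply: (continuous_bounded_borel (proj1 grho0)
      (is_class_of_bounded_borel (urho_cls 0%N))) => t; exact: gP.
  by move=> n; have [] := fP n.
Qed.

End Entwining.

Theorem corollary2p31 (R : realType) (G H : topGroupoid)
    (etG : etale G) (hsG : hausdorff_space (units G))
    (lcG : locally_compact [set: units G])
    (etH : etale H) (hsH : hausdorff_space (units H))
    (lcH : locally_compact [set: units H])
    (h : actor G H) (hproper : proper_actor h)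
    (hausG : hausdorff_space G) :
  (forall U : set G, open_bisection U ->
     ((forall V : set (units H), open V -> precompact V ->
         meagre (stable_set h U `&` V))
      <-> stable_set h U = set0)) /\
  (forall (A : fullCstar R G) (B : fullCstar R H) (phi : A -> B)
     (jA : (units G -> R[i]) -> A) (jB : (units H -> R[i]) -> B)
     (ELA : A -> Mloc R (units G)) (ELB : B -> Mloc R (units H)),
     is_induced_hom h phi ->
     is_C0_inclusion jA -> is_C0_inclusion jB ->
     is_local_expectation ELA -> is_local_expectation ELB ->
     (entwines phi jA jB ELA ELB
      <-> forall U : set G, bisection U -> stable_set h U = set0)) /\
  ((forall U : set G, bisection U -> stable_set h U = set0)
   <-> free_actor h).
Proof.
split; first by move=> U; exact: stable_set_meagre_eq0.
split; last exact: stable_sets_eq0_free.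
move=> A B phi jA jB ELA ELB hphi hjA hjB hELA hELB; split.
  move=> ent; apply/stable_sets_eq0_free.
  exact: (entwines_free etG hsG lcG etH hsH lcH hproper hausG hphi hjA hjB hELA
    hELB).
move=> /stable_sets_eq0_free.
exact: (free_entwines etG hsG lcG etH hsH hproper hausG hphi hjA hjB hELA
  hELB).
Qed.
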